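(* Consider the charged-particle dynamics $\ddot x=\dot x\times B(x)+F(x)$ in $\mathbb{R}^3$ with $B=\nabla\times A$ and $F=-\nabla U$. Let $(x_n,v_n)$ be the numerical solution obtained with stepsize $h>0$ by the two-step method $$\begin{aligned}x_{n+1}-2x_n+x_{n-1}=&\tfrac h2A'^{\intercal}(x_{n+1/2})(x_{n+1}-x_n)+\tfrac h2A'^{\intercal}(x_{n-1/2})(x_n-x_{n-1})\\&-h\big(A(x_{n+1/2})-A(x_{n-1/2})\big)+\tfrac{h^2}2\big(F(x_{n+1/2})+F(x_{n-1/2})\big),\end{aligned}$$ together with $v_{n+1}=2\frac{x_{n+1}-x_n}h-v_n$, where $x_{n\pm1/2}=\frac{x_n+x_{n\pm1}}2$ and $v_{n+1/2}=\frac{v_n+v_{n+1}}2$. Assume that the numerical solution $(x_n,v_n)$ stays in a compact set that is independent of $h$. Let $N\ge2$ be an arbitrary integer. Then the energy $E(x,v)=\frac12|v|^2+U(x)$ satisfies $$|E(x_{n+1/2},v_{n+1/2})-E(x_{1/2},v_{1/2})|\le Ch^2\qquad\text{for } nh\le h^{-N},$$ where the constant $C$ is independent of $n$ and $h$ as long as $nh\le h^{-N}$.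
   Context: The method is called TSM2; the setting is a normal magnetic field (scaling parameter $\epsilon=1$). $A:\mathbb{R}^3\to\mathbb{R}^3$ (vector potential) and $U:\mathbb{R}^3\to\mathbb{R}$ (scalar potential) are assumed smooth; $A'(x)$ is the Jacobian matrix of $A$ and $A'^{\intercal}(x)$ its transpose. The initial values $x_0$ and $v_0$ are bounded independently of $h$. $|\cdot|$ is the Euclidean norm and $\times$ the cross product. *)

(* Defs.v *)
From mathcomp Require Import all_boot all_order all_algebra.
From mathcomp Require Import all_classical all_reals all_analysis.

Set Implicit Arguments.
Unset Strict Implicit.
Unset Printing Implicit Defensive.

Import Order.TTheory GRing.Theory Num.Theory.
Import numFieldNormedType.Exports.

Local Open Scope classical_set_scope.
Local Open Scope ring_scope.

(* Points of R^3 are row vectors. Their library norm `|x| is the max norm, hence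
   the separate Euclidean norm. *)
Definition enorm (R : realType) (x : 'rV[R]_3) : R :=
  Num.sqrt (\sum_(i < 3) x 0 i ^+ 2).

Definition partial (R : realType) (W : normedModType R) (i : 'I_3)
    (f : 'rV[R]_3 -> W) (x : 'rV[R]_3) : W :=
  'D_(delta_mx 0 i) f x.

Fixpoint Ck (R : realType) (W : normedModType R) (k : nat)
    (f : 'rV[R]_3 -> W) : Prop :=
  match k with
  | 0%N => continuous f
  | k'.+1 => continuous f /\
      forall i : 'I_3, (forall x, derivable f x (delta_mx 0 i)) /\
                       Ck k' (partial i f)
  end.

Definition smooth (R : realType) (W : normedModType R)
    (f : 'rV[R]_3 -> W) : Prop :=
  forall k, Ck k f.

Definition grad (R : realType) (U : 'rV[R]_3 -> R^o) (x : 'rV[R]_3) :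
    'rV[R]_3 :=
  \row_i partial i U x.

(* Indices are taken in 'I_3, i.e. modulo 3. *)
Definition curl (R : realType) (A : 'rV[R]_3 -> 'rV[R]_3) (x : 'rV[R]_3) :
    'rV[R]_3 :=
  \row_(i < 3) (partial (i + 1) (fun y => A y 0 (i + 2) : R^o) x
              - partial (i + 2) (fun y => A y 0 (i + 1) : R^o) x).

(* The library Jacobian 'J A y acts on rows from the right, so its (i, j) entry
   is the i-th partial derivative of A_j, and the Jacobian matrix A'(y) is its
   transpose. For a row w, the product of the transpose of A'(y) with the column
   w^T, read as a row, is w *m A'(y). *)
Definition trJ_mul (R : realType) (A : 'rV[R]_3 -> 'rV[R]_3)
    (y w : 'rV[R]_3) : 'rV[R]_3 :=
  w *m ('J A y)^T.

(* midpoint z n is z_{n+1/2}. *)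
Definition midpoint (R : realType) (z : nat -> 'rV[R]_3) (n : nat) : 'rV[R]_3 :=
  2^-1 *: (z n + z n.+1).

(* The two-step recursion is centred at index n + 1, so n.+1 ranges over the
   positive integers; the starting value x 1 is left free. *)
Definition TSM2 (R : realType) (A F : 'rV[R]_3 -> 'rV[R]_3) (h : R)
    (x v : nat -> 'rV[R]_3) : Prop :=
  (forall n : nat,
     x n.+2 - 2 *: x n.+1 + x n =
       (h / 2) *: trJ_mul A (midpoint x n.+1) (x n.+2 - x n.+1)
     + (h / 2) *: trJ_mul A (midpoint x n) (x n.+1 - x n)
     - h *: (A (midpoint x n.+1) - A (midpoint x n))
     + (h ^+ 2 / 2) *: (F (midpoint x n.+1) + F (midpoint x n)))
  /\ (forall n : nat, v n.+1 = (2 / h) *: (x n.+1 - x n) - v n).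

Definition energy (R : realType) (U : 'rV[R]_3 -> R^o) (x v : 'rV[R]_3) : R :=
  2^-1 * enorm v ^+ 2 + U x.

(* Main.v *)
From HB Require Import structures.
Require Import Defs.
From mathcomp Require Import all_boot all_order all_algebra.
From mathcomp Require Import all_classical all_reals all_analysis.
From mathcomp Require Import ring.
Import Order.TTheory GRing.Theory Num.Theory.
Import numFieldNormedType.Exports.
Local Open Scope classical_set_scope.
Local Open Scope ring_scope.

(** Write y_n = x_{n+1/2}, p_n = v_{n+1/2} = (x_{n+1} - x_n) / h and
    q_n = p_n + A(y_n).  In these variables the method is the trapezoidal rule
      y_{n+1} - y_n = h/2 (p_n + p_{n+1}),  q_{n+1} - q_n = h/2 (G_n + G_{n+1}),
      G = A'^T(y) p - grad U(y),
    for the Hamiltonian system with energy H = |q - A(y)|^2 / 2 + U(y), which is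
    the energy of the statement.  The trapezoidal rule is conjugate to the
    symplectic midpoint rule; the consequence needed here is obtained by finite
    differences, without modified equations or implicit function arguments.

    Smoothness of the numerical trajectory.  As the solution stays in a compact
    set, y and q are bounded; and if their differences up to order k are
    O(h^j), j <= k, then so are those of p and G, which are smooth functions of
    (y, q), so the recursion bounds the differences of order k + 1 by
    O(h^(k+1)).  Hence the j-th differences are O(h^j) for every j
    ([trapezoidal_smoothseq]).  The induction rests on the fact that smooth
    functions preserve this class of sequences: the interpolation polynomial of
    such a sequence is a curve whose j-th derivative is O(h^j), this property of
    curves is stable under composition with smooth maps by the chain rule
    ([hsmooth_comp]), and such a curve is, up to O(h^k), a polynomial of degree
    less than k ([hsmooth_poly_approx]), so that its k-th difference is O(h^k).

    A difference formula that obeys the chain rule.  Let d be a linear formula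
    on finitely many nodes that gives the derivative at one node exactly on
    polynomials of degree less than k.  On the sequences above it is the
    derivative of the interpolating curve up to O(h^k), so with
    f = (p, G) = J^-1 grad H and the symplectic form w,
      d[H]_c = w(f_c, d[z]_c) + O(h^k),  z = (y, q)   ([energy_rule]).

    Telescoping.  Take for d the central formula on 2r + 1 nodes
    ([central_difference]); here k = 2r + 1.  The recursion turns
    z_{c+j} - z_{c-j} into h/2 times a combination of the f_{c+i} that is
    symmetric in i, and antisymmetry of w gives
      w(f_c, f_{c+i}) + w(f_c, f_{c-i}) = V_i(c) - V_i(c-i),
      V_i(c) = w(f_c, f_{c+i}) = O(h).
    Summed over n consecutive c, the main part of d[H] therefore reduces to
    boundary terms h * O(h), while the errors add up to n O(h^(2r+1)).  On the
    other hand the sum of d[H]_c is itself a boundary expression, equal to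
    H_n - H_0 up to a few one-step increments of H, each O(h^2) by the same
    chain rule applied to the forward difference ([energy_local_error]).  Thus
      |H_n - H_0| <= C (h^2 + n h^(2r+1))   ([energy_long_time]),
    and r = N suffices because n h <= h^-N and N >= 2.  Only n = 0 is possible
    when h > 1. *)

Set Implicit Arguments.
Unset Strict Implicit.
Unset Printing Implicit Defensive.

(** * Differentiability and chain rule from continuous partial derivatives *)

Lemma is_derive_line (R : realType) n (f : 'rV[R]_n -> R^o) (a e : 'rV[R]_n)
    (t : R) :
  derivable f (a + t *: e) e ->
  is_derive (t : R^o) (1 : R^o) (fun s : R^o => f (a + s *: e) : R^o)
    ('D_e f (a + t *: e)).
Proof.
move=> dfe.
have E : (fun h : R => h^-1 *: (((fun s : R^o => f (a + s *: e) : R^o)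
            \o shift (t : R^o)) (h *: (1 : R^o)) - f (a + t *: e))) =
    (fun h => h^-1 *: ((f \o shift (a + t *: e)) (h *: e) - f (a + t *: e))).
  apply/funext => h /=; congr (_ *: (f _ - _)).
  by rewrite [h *: 1]mulr1 scalerDl addrCA.
by split; rewrite /derivable /derive E.
Qed.

(** The increment [s] may be negative, hence the bound on [t] by absolute
    values. *)
Lemma partial_MVT (R : realType) n (f : 'rV[R]_n -> R^o) (a e : 'rV[R]_n)
    (s : R) :
  (forall x, derivable f x e) ->
  exists2 t : R, `|t| <= `|s| & f (a + s *: e) - f a = s * 'D_e f (a + t *: e).
Proof.
move=> df.
pose g : R^o -> R^o := fun s => f (a + s *: e).
have dg t : is_derive (t : R^o) (1 : R^o) g ('D_e f (a + t *: e)).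
  exact: is_derive_line.
have cg : continuous (g : R -> R).
  move=> t; apply/differentiable_continuous/derivable1_diffP.
  exact: (@ex_derive _ _ _ _ _ _ _ (dg t)).
have g0 : g 0 = f a by rewrite /g scale0r addr0.
have [s0|s0] := leP 0 s.
  have [c + E] := @MVT_segment R g (fun t => 'D_e f (a + t *: e)) 0 s s0
     (fun x _ => dg x) (continuous_subspaceT cg).
  rewrite in_itv /= => /andP[c0 cs]; exists c; first by rewrite !ger0_norm.
  by rewrite -g0 -[f (a + s *: e)]/(g s) E subr0 mulrC.
have [c + E] := @MVT_segment R g (fun t => 'D_e f (a + t *: e)) s 0 (ltW s0)
     (fun x _ => dg x) (continuous_subspaceT cg).
rewrite in_itv /= => /andP[cs c0]; exists c.
  by rewrite !ler0_norm ?lerN2 // ltW.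
by rewrite -g0 -[f (a + s *: e)]/(g s) -opprB E sub0r mulrN opprK mulrC.
Qed.

Lemma coord_le_norm (R : realType) n (x : 'rV[R]_n) i : `|x 0 i| <= `|x|.
Proof.
rewrite [leRHS]/Num.Def.normr /= mx_normrE.
exact: (le_bigmax _ (fun ij : 'I_1 * 'I_n => `|x ij.1 ij.2|) (0, i)).
Qed.

(** The increment is split along the coordinate axes; on each piece the mean
    value theorem gives a partial derivative at a nearby point, and these are
    close to the ones at [x] by continuity. *)
Lemma C1_linearization (R : realType) (f : 'rV[R]_3 -> R^o) (x : 'rV[R]_3) :
  Ck 1 f -> forall e : R, 0 < e -> \forall w \near (0 : 'rV[R]_3),
    `|f (x + w) - f x - \sum_i w 0 i * partial i f x| <= e * `|w|.
Proof.
move=> [_ df] e e0.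
have e3 : 0 < e / 3 by rewrite divr_gt0.
have [d d0 Hd] : exists2 d : R, 0 < d & forall i (z : 'rV[R]_3), `|z| < d ->
    `|partial i f (x + z) - partial i f x| <= e / 3.
  have H i : \forall z \near (0 : 'rV[R]_3),
      `|partial i f (x + z) - partial i f x| <= e / 3.
    have [_ ci] := df i.
    have /cvgrPdist_le/(_ _ e3) := ci x.
    rewrite [X in X -> _](near_shift 0 x) subr0; apply: filterS => z /=.
    by rewrite distrC [z + x]addrC.
  have : \forall z \near (0 : 'rV[R]_3),
      forall i, `|partial i f (x + z) - partial i f x| <= e / 3.
    exact: (@filter_forall _ _
      (fun i z => `|partial i f (x + z) - partial i f x| <= e / 3)
      (nbhs (0 : 'rV[R]_3)) _ H).
  move=> /nbhs_ballP[d /= d0 Hd]; exists d => // i z zd.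
  by apply: Hd; rewrite -ball_normE /= sub0r normrN.
near=> w.
have wd : `|w| < d by near: w; exact: (@nbhs0_lt _ 'rV[R]_3).
(* The vertices of the path from 0 to [w] along the coordinate axes. *)
pose W k : 'rV[R]_3 := \row_(j < 3) (if (j < k)%N then w 0 j else 0).
have WS (k : 'I_3) : W k.+1 = W k + w 0 k *: delta_mx 0 k.
  apply/rowP => j; rewrite !mxE eqxx /= ltnS leq_eqVlt -val_eqE /=.
  have [/val_inj ->|jk] /= := eqVneq (val j) (val k).
    by rewrite ltnn add0r mulr1.
  by rewrite mulr0 addr0.
have W0 : W 0%N = 0 by apply/rowP => j; rewrite !mxE.
have W3 : W 3%N = w by apply/rowP => j; rewrite !mxE ltn_ord.
have -> : f (x + w) - f x = \sum_(k < 3) (f (x + W k.+1) - f (x + W k)).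
  rewrite -{1}W3 -[in f x](addr0 x) -W0.
  by rewrite -(telescope_sumr (fun k => f (x + W k))) // big_mkord.
rewrite -sumrB; apply: le_trans (ler_norm_sum _ _ _) _.
have -> : e * `|w| = \sum_(k < 3) (e / 3 * `|w|).
  by rewrite sumr_const card_ord -mulr_natr; field.
apply: ler_sum => k _.
have [t ts E] := @partial_MVT R 3 f (x + W k) (delta_mx 0 k) (w 0 k) (df k).1.
rewrite WS addrA E -[X in `|X - _|]/(w 0 k * partial k f _) -mulrBr normrM.
rewrite mulrC.
apply: ler_pM => //; last exact: coord_le_norm.
rewrite -addrA; apply: Hd; apply: le_lt_trans wd.
rewrite [leLHS]/Num.Def.normr /= mx_normrE; apply/bigmax_le => // -[i j] _ /=.
rewrite !mxE; have [->|jk] := eqVneq j k.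
  by rewrite ltnn add0r [i]ord1 mulr1 (le_trans ts) // coord_le_norm.
rewrite andbF mulr0 addr0; case: ifP => _; last by rewrite normr0.
exact: coord_le_norm.
Unshelve. all: by end_near. Qed.

Lemma C1_differentiable (R : realType) (f : 'rV[R]_3 -> R^o) (x : 'rV[R]_3) :
  Ck 1 f -> differentiable f x.
Proof.
move=> /[dup] cf /C1_linearization H.
pose l (w : 'rV[R]_3) : R^o := \sum_i w 0 i * partial i f x.
have lin_l : linear l.
  move=> a u v; rewrite /l scaler_sumr -big_split; apply: eq_bigr => i _ /=.
  by rewrite !mxE mulrDl -mulrA.
pose L : {linear 'rV[R]_3 -> R^o} :=
  HB.pack l (GRing.isLinear.Build _ _ _ _ _ lin_l).
have cl : continuous L.
  apply: continuous_big => [|i _ w]; first exact: add_continuous.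
  apply: (@continuousM R 'rV[R]_3 (fun v => v 0 i) (fun=> partial i f x)).
    exact: coord_continuous.
  exact: cst_continuous.
have E : f \o shift x = cst (f x) + (L : 'rV[R]_3 -> R^o)
    +o_ (0 : 'rV[R]_3) (id : 'rV[R]_3 -> 'rV[R]_3).
  apply/eqaddoP => e e0; near=> w => /=.
  rewrite fctE /= [w + x]addrC opprD addrA.
  by near: w; exact: H.
by apply/diff_locallyP; rewrite (diff_unique cl E); split.
Unshelve. all: by end_near. Qed.

Lemma smooth_continuous (R : realType) (W : normedModType R)
    (f : 'rV[R]_3 -> W) : smooth f -> continuous f.
Proof. by move=> /(_ 0%N). Qed.

Lemma smooth_partial (R : realType) (W : normedModType R)
    (f : 'rV[R]_3 -> W) i :
  smooth f -> smooth (partial i f).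
Proof. by move=> sf k; have [_ /(_ i)[]] := sf k.+1. Qed.

Lemma partial_coord (R : realType) (A : 'rV[R]_3 -> 'rV[R]_3) i j x :
  derivable A x (delta_mx 0 i) ->
  partial i (fun y => A y 0 j : R^o) x = partial i A x 0 j.
Proof. by move=> dA; rewrite [in RHS]/partial derive_mx // mxE. Qed.

Lemma smooth_coord (R : realType) (A : 'rV[R]_3 -> 'rV[R]_3) j :
  smooth A -> smooth (fun y => A y 0 j : R^o).
Proof.
move=> sA k; elim: k A sA => [|k IH] A sA.
  move=> x; apply: (@continuous_comp _ _ _ A (fun v : 'rV[R]_3 => v 0 j)).
    exact: smooth_continuous.
  exact: coord_continuous.
split=> [|i]; first by have := IH _ sA; case: (k) => [|?] // [].
have dA x : derivable A x (delta_mx 0 i) by have [_ /(_ i)[]] := sA 1%N.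
split=> [x|]; first by have /derivable_mxP := dA x; apply.
have -> : partial i (fun y => A y 0 j : R^o) = (fun y => partial i A y 0 j).
  by apply/funext => x; apply: partial_coord.
exact/IH/smooth_partial.
Qed.

Lemma diff_partial (R : realType) (f : 'rV[R]_3 -> R^o) (x w : 'rV[R]_3) :
  differentiable f x -> 'd f x w = \sum_i w 0 i * partial i f x.
Proof.
move=> df; rewrite {1}[w]row_sum_delta linear_sum; apply: eq_bigr => i _.
by rewrite linearZ /partial deriveE.
Qed.

Lemma smooth_differentiable (R : realType) (A : 'rV[R]_3 -> 'rV[R]_3) x :
  smooth A -> differentiable A x.
Proof.
move=> sA.
have -> : A =
    \sum_(j < 3) (fun y => (A y 0 j : R) *: (delta_mx 0 j : 'rV[R]_3)).
  by apply/funext => y; rewrite fct_sumE [LHS]row_sum_delta.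
apply: differentiable_sum => j; apply: differentiableZl.
exact: (C1_differentiable x (smooth_coord j sA 1%N)).
Qed.

(** Turns the Jacobian of [trJ_mul], which is meaningful because [A] is
    differentiable, into the partial derivatives of the chain rule. *)
Lemma trJ_mulE (R : realType) (A : 'rV[R]_3 -> 'rV[R]_3) (y w : 'rV[R]_3) i :
  smooth A ->
  trJ_mul A y w 0 i = \sum_j w 0 j * partial i (fun z => A z 0 j : R^o) y.
Proof.
move=> sA; rewrite /trJ_mul mxE; apply: eq_bigr => j _; congr (_ * _).
have dA := smooth_differentiable y sA.
rewrite partial_coord; last exact: diff_derivable.
by rewrite /partial deriveE // !mxE.
Qed.

Lemma is_derive_curve (R : realType) (f : 'rV[R]_3 -> R^o) (c : 'I_3 -> R -> R)
    (c' : 'I_3 -> R) (t : R) :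
  Ck 1 f -> (forall i, is_derive t 1 (c i) (c' i)) ->
  is_derive t 1 (fun s => f (\row_i c i s) : R)
    (\sum_i c' i * partial i f (\row_i c i t)).
Proof.
move=> cf dc.
pose g (s : R) : 'rV[R]_3 := \row_i c i s.
have gE i j : (fun s : R => g s i j) = c j by apply/funext => s; rewrite mxE.
have dg : derivable g t 1 by apply/derivable_mxP => i j; rewrite gE.
have dg' := (derivable1_diffP _ _).1 dg.
have df := C1_differentiable (g t) cf.
have dfg : differentiable (f \o g) t by exact: differentiable_comp.
split; first exact/(derivable1_diffP (f \o g)).
have dgE : 'd g t 1 = \row_i c' i.
  rewrite -deriveE // derive_mx //; apply/rowP => i.
  by rewrite !mxE gE derive_val.
rewrite -[LHS]/('D_1 (f \o g) t) deriveE // diff_comp //= dgE diff_partial //.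
by apply: eq_bigr => i _; rewrite mxE.
Qed.

(** * Curves whose j-th derivative is of size h^j *)

Lemma continuous_bounded_ball (R : realType) (f : 'rV[R]_3 -> R^o) (M : R) :
  continuous f -> exists C : R, forall x, `|x| <= M -> `|f x| <= C.
Proof.
move=> cf.
have cB : compact [set x : 'rV[R]_3 | `|x| <= M].
  apply: bounded_closed_compact.
    exists M; split; first exact: num_real.
    by move=> N MN x /= xM; apply: le_trans (ltW MN).
  apply: (@closed_comp 'rV[R]_3 R (fun x => `|x|) [set r | r <= M]).
    by move=> x _; exact: norm_continuous.
  exact: closed_le.
have /compact_bounded[N [_ HN]] : compact (f @` [set x : 'rV[R]_3 | `|x| <= M]).
  by apply: continuous_compact cB; apply: continuous_subspaceT.
exists (N + 1) => x xM; apply: HN; first by rewrite ltrDl.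
by exists x.
Qed.

Section ScaledSmoothness.
Variables (R : realType) (I : Type) (h : I -> R) (L : nat).
Implicit Types (phi chi : I -> R -> R) (k : nat).

(** A family of curves indexed by [I], with one scale [h i] per index, all of
    whose derivatives up to order [k] exist, the [j]-th one being O(h^j) on
    [0, L] uniformly in the index.  Factoring [h i] out of the derivative makes
    the notion recursive, so that closure properties are inductions on [k]. *)
Fixpoint hsmooth k phi : Prop :=
  (exists C, forall i t, 0 <= t <= L%:R -> `|phi i t| <= C) /\
  if k is k'.+1 then
    exists2 psi, (forall i (t : R), is_derive t 1 (phi i) (h i * psi i t)) &
                 hsmooth k' psi
  else True.

Lemma hsmooth_bounded k phi : hsmooth k phi ->
  exists C, forall i t, 0 <= t <= L%:R -> `|phi i t| <= C.
Proof. by case: k => [|k] []. Qed.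

Lemma hsmoothW k phi : hsmooth k.+1 phi -> hsmooth k phi.
Proof.
elim: k phi => [|k IH] phi [b]; first by [].
by move=> [psi dphi /IH hpsi]; split=> //; exists psi.
Qed.

Lemma hsmooth_cst k (a : I -> R) :
  (exists C, forall i, `|a i| <= C) -> hsmooth k (fun i _ => a i).
Proof.
elim: k a => [|k IH] a [C aC]; split=> //; try by exists C.
exists (fun _ _ => 0) => [i t|].
  by rewrite mulr0; apply: is_derive_cst.
by apply: IH; exists 0 => i; rewrite normr0.
Qed.

Lemma hsmoothD k phi chi : hsmooth k phi -> hsmooth k chi ->
  hsmooth k (fun i t => phi i t + chi i t).
Proof.
elim: k phi chi => [|k IH] phi chi [[C bC] H] [[D bD] H'].
all: split; first by exists (C + D) => i t tL;
  rewrite (le_trans (ler_normD _ _)) // lerD ?bC ?bD.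
  by [].
move: H H' => [psi dphi hpsi] [xi dchi hxi].
exists (fun i t => psi i t + xi i t) => [i t|]; last exact: IH.
rewrite mulrDr; have := dphi i t; have := dchi i t => ? ?.
exact: is_deriveD.
Qed.

Lemma hsmoothM k phi chi : hsmooth k phi -> hsmooth k chi ->
  hsmooth k (fun i t => phi i t * chi i t).
Proof.
have bM phi' chi' : hsmooth 0 phi' -> hsmooth 0 chi' ->
    hsmooth 0 (fun i t => phi' i t * chi' i t).
  move=> [[C bC] _] [[D bD] _]; split=> //; exists (C * D) => i t tL.
  by rewrite normrM ler_pM ?bC ?bD.
elim: k phi chi => [|k IH] phi chi; first exact: bM.
move=> Hphi Hchi; split.
  have Hphi0 : hsmooth 0 phi by split=> //; exact: hsmooth_bounded Hphi.
  have Hchi0 : hsmooth 0 chi by split=> //; exact: hsmooth_bounded Hchi.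
  exact: hsmooth_bounded (bM _ _ Hphi0 Hchi0).
move: (Hphi) (Hchi) => [_ [psi dphi hpsi]] [_ [xi dchi hxi]].
exists (fun i t => phi i t * xi i t + chi i t * psi i t) => [i t|].
  have := dphi i t; have := dchi i t => dc dp.
  have -> : h i * (phi i t * xi i t + chi i t * psi i t) =
      phi i t *: (h i * xi i t) + chi i t *: (h i * psi i t).
    by rewrite /GRing.scale /=; ring.
  exact: is_deriveM.
by apply: hsmoothD; apply: IH => //; exact: hsmoothW.
Qed.

Lemma hsmooth_sum k n (phi : 'I_n -> I -> R -> R) :
  (forall j, hsmooth k (phi j)) -> hsmooth k (fun i t => \sum_j phi j i t).
Proof.
elim: n phi => [|n IH] phi H.
  under eq_fun do under eq_fun do rewrite big_ord0.
  by apply: hsmooth_cst; exists 0 => i; rewrite normr0.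
under eq_fun do under eq_fun do rewrite big_ord_recl.
by apply: hsmoothD => //; apply: IH.
Qed.

Lemma hsmoothZ k (a : R) phi :
  hsmooth k phi -> hsmooth k (fun i t => a * phi i t).
Proof. by apply: hsmoothM; apply: hsmooth_cst; exists `|a|. Qed.

Lemma hsmoothB k phi chi : hsmooth k phi -> hsmooth k chi ->
  hsmooth k (fun i t => phi i t - chi i t).
Proof.
move=> hp hc; have := hsmoothD hp (hsmoothZ (-1) hc).
by under eq_fun do under eq_fun do rewrite mulN1r.
Qed.

(** By the chain rule the derivative is h times a sum of products of the scaled
    derivatives of the [c j] with partial derivatives of [f] along the curve,
    to which the induction hypothesis applies.  Boundedness comes from
    continuity of [f] on a ball. *)
Lemma hsmooth_comp k (f : 'rV[R]_3 -> R^o) (c : 'I_3 -> I -> R -> R) :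
  smooth f -> (forall j, hsmooth k (c j)) ->
  hsmooth k (fun i t => f (\row_j c j i t)).
Proof.
have b0 k' f' c' : smooth f' -> (forall j, hsmooth k' (c' j)) ->
    exists C, forall i t, 0 <= t <= L%:R -> `|f' (\row_j c' j i t) : R| <= C.
  move=> sf' hc.
  have [C HC] := choice (fun j => hsmooth_bounded (hc j)).
  have [D HD] :=
    @continuous_bounded_ball R f' (\sum_j `|C j|) (smooth_continuous sf').
  exists D => i t tL; apply: HD.
  rewrite [leLHS]/Num.Def.normr /= mx_normrE.
  apply/bigmax_le => [|[a j] _ /=]; first exact: sumr_ge0.
  rewrite mxE (le_trans (HC j i t tL)) // (le_trans (ler_norm _)) //.
  by rewrite (bigD1 j) //= lerDl sumr_ge0.
elim: k f c => [|k IH] f c sf hc; first by split=> //; exact: (b0 0%N).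
split; first exact: (b0 k.+1).
have : forall j, exists psi,
    (forall i (t : R), is_derive t 1 (c j i) (h i * psi i t)) /\ hsmooth k psi.
  by move=> j; have [_ [psi ? ?]] := hc j; exists psi.
move=> /choice[psi Hpsi].
exists (fun i t => \sum_j psi j i t * partial j f (\row_j c j i t)) => [i t|].
  have := @is_derive_curve R f (fun j => c j i) (fun j => h i * psi j i t) t
    (sf 1%N) (fun j => (Hpsi j).1 i t).
  suff -> : h i * \sum_j psi j i t * partial j f (\row_j c j i t) =
      \sum_j h i * psi j i t * partial j f (\row_j c j i t) by [].
  by rewrite mulr_sumr; apply: eq_bigr => j _; rewrite mulrA.
apply: hsmooth_sum => j; apply: hsmoothM; first exact: (Hpsi j).2.
by apply: IH => [|j']; [exact: smooth_partial|exact: hsmoothW].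
Qed.

End ScaledSmoothness.

Lemma poly_bounded_segment (R : realType) (B : {poly R}) (L : R) :
  exists C, forall t, 0 <= t <= L -> `|B.[t]| <= C.
Proof.
exists (\sum_(j < size B) `|B`_j| * L ^+ j) => t /andP[t0 tL].
rewrite horner_coef (le_trans (ler_norm_sum _ _ _)) //; apply: ler_sum => j _.
rewrite normrM ler_wpM2l // normrX ger0_norm // lerXn2r // nnegrE.
exact: le_trans tL.
Qed.

Lemma exists_antideriv (R : realType) (q : {poly R}) :
  exists p : {poly R}, p^`() = q /\ (size p <= (size q).+1)%N.
Proof.
(* The constant coefficient is a division by 0, hence 0. *)
exists (\poly_(i < (size q).+1) (q`_i.-1 / i%:R)).
split; last exact: size_poly.
apply/polyP => i; rewrite coef_deriv coef_poly ltnS.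
case: ltnP => [_|qi]; last by rewrite mul0rn nth_default.
by rewrite /= -(mulr_natr (_ / _)) divfK // pnatr_eq0.
Qed.

Lemma derive1_bound (R : realType) (g g' : R -> R) (B t : R) :
  0 <= t -> (forall s : R, is_derive s 1 g (g' s)) ->
  (forall s, 0 <= s <= t -> `|g' s| <= B) -> `|g t - g 0| <= B * t.
Proof.
move=> t0 dg bg.
have cg : continuous g.
  move=> s; apply/differentiable_continuous/derivable1_diffP.
  exact: (@ex_derive _ _ _ _ _ _ _ (dg s)).
have [s + ->] := MVT_segment t0 (fun s _ => dg s) (continuous_subspaceT cg).
rewrite in_itv /= => st; rewrite subr0 normrM (ger0_norm t0).
by apply: ler_wpM2r => //; apply: bg.
Qed.

Section PolynomialApproximation.
Variables (R : realType) (I : Type) (h : I -> R) (L : nat).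
Hypothesis h01 : forall i, 0 < h i <= 1.
Implicit Types (phi chi : I -> R -> R) (k : nat).

Let h0 i : 0 < h i. Proof. by case/andP: (h01 i). Qed.

Lemma hX_le1 i m : h i ^+ m <= 1.
Proof. by apply: exprn_ile1; [exact: ltW | case/andP: (h01 i)]. Qed.

(** Each derivative lowers the degree of [B] by one and may consume one power of
    [h] from [a]; after [m] of them either the polynomial has vanished or the
    required order has been reached. *)
Lemma hsmooth_scaled_poly k m (a : I -> R) (B : {poly R}) :
  (exists C, forall i, `|a i| <= C * h i ^+ m) ->
  (size B <= m.+1)%N || (k <= m)%N ->
  hsmooth h L k (fun i t => a i * B.[t]).
Proof.
have b0 m' a' (B' : {poly R}) :
    (exists C, forall i, `|a' i| <= C * h i ^+ m') ->
    exists C, forall (i : I) t, 0 <= t <= L%:R -> `|a' i * B'.[t]| <= C.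
  move=> [C aC]; have [D BD] := poly_bounded_segment B' L%:R.
  exists (`|C| * D) => i t tL; rewrite normrM ler_pM ?BD //.
  apply: le_trans (aC i) _; rewrite -[leRHS]mulr1.
  apply: le_trans (_ : `|C| * h i ^+ m' <= _).
    by rewrite ler_wpM2r ?exprn_ge0 ?ler_norm // ltW.
  by rewrite ler_wpM2l // hX_le1.
elim: k m a B => [|k IH] m a B aO sB; first by split=> //; exact: b0 aO.
split; first exact: b0 aO.
case: m aO sB => [|m] aO sB.
  rewrite orbF in sB; rewrite (size1_polyC sB).
  exists (fun _ _ => 0) => [i t|].
    by under eq_fun do rewrite hornerC; rewrite mulr0; apply: is_derive_cst.
  by apply: hsmooth_cst; exists 0 => i; rewrite normr0.
exists (fun i t => a i / h i * B^`().[t]) => [i t|].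
  have -> : h i * (a i / h i * B^`().[t]) = a i *: B^`().[t].
    by rewrite /GRing.scale /=; field; rewrite gt_eqF.
  exact: is_deriveZ.
apply: (IH m) => [|].
  case: aO => C aC; exists C => i.
  by rewrite normrM normfV (gtr0_norm (h0 i)) ler_pdivrMr // -mulrA -exprSr.
case/orP: sB => sB; last by rewrite -[(k <= m)%N]/(k < m.+1)%N sB orbT.
by rewrite (leq_trans (size_poly _ _)) //; case: (size B) sB.
Qed.

(** The polynomial is built by integrating the one obtained for the scaled
    derivative, starting from the value at 0; it is the Taylor polynomial,
    without any mention of higher derivatives.  The first derivative is
    approximated as well, because differentiation formulas are compared with
    it. *)
Lemma hsmooth_poly_approx k phi : hsmooth h L k phi ->
  exists2 p : I -> {poly R}, forall i, (size (p i) <= k)%N &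
  exists C, forall i t, 0 <= t <= L%:R ->
    `|phi i t - (p i).[t]| <= C * h i ^+ k /\
    ((0 < k)%N -> `|(phi i)^`()%classic t - (p i)^`().[t]| <= C * h i ^+ k).
Proof.
elim: k phi => [|k IH] phi.
  move=> [[C bC] _]; exists (fun _ => 0) => [i|]; first by rewrite size_poly0.
  by exists C => i t tL; rewrite horner0 subr0 mulr1 bC.
move=> [_ [psi dphi /IH[q sq [C qC]]]].
have [P HP] := choice (fun i => exists_antideriv (h i *: q i)).
exists (fun i => P i + (phi i 0 - (P i).[0])%:P) => [i|].
  rewrite (leq_trans (size_polyD _ _)) // geq_max.
  rewrite (leq_trans (size_polyC_leq1 _)) // andbT.
  have [_ /leq_trans] := HP i; apply.
  by rewrite ltnS (leq_trans (size_scale_leq _ _)).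
have dP i t : (P i + (phi i 0 - (P i).[0])%:P)^`().[t] = h i * (q i).[t].
  by rewrite derivD derivC addr0; have [-> _] := HP i; rewrite hornerZ.
have E1 i t : 0 <= t <= L%:R ->
    `|h i * psi i t - h i * (q i).[t]| <= C * h i ^+ k.+1.
  move=> tL; rewrite -mulrBr normrM gtr0_norm // exprS mulrCA.
  by rewrite ler_wpM2l ?(ltW (h0 i)) //; have [] := qC i t tL.
exists (`|C| * (1 + L%:R)) => i t tL.
have CE : C * h i ^+ k.+1 <= `|C| * h i ^+ k.+1.
  by rewrite ler_wpM2r ?ler_norm // exprn_ge0 // ltW.
have [t0 tL'] := andP tL.
split=> [|_]; last first.
  rewrite dP derive1E derive_val (le_trans (E1 i t tL)) // (le_trans CE) //.
  by rewrite -mulrA ler_wpM2l // ler_peMl ?lerDl // exprn_ge0 // ltW.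
set p := P i + _.
pose g t := phi i t - p.[t].
have g00 : g 0 = 0 by rewrite /g /p hornerD hornerC addrCA subrr addr0 subrr.
have dg (s : R) : is_derive s 1 g (h i * psi i s - h i * (q i).[s]).
  by have := dphi i s; rewrite -dP => ?; exact: is_deriveB.
rewrite -[X in `|X|]/(g t) -[g t]subr0 -g00.
apply: (le_trans (derive1_bound t0 dg (B := `|C| * h i ^+ k.+1) _)).
  move=> s /andP[s0 st]; apply: le_trans CE; apply: E1.
  by rewrite s0 (le_trans st).
rewrite -!mulrA ler_wpM2l // mulrC ler_wpM2r ?exprn_ge0 ?(ltW (h0 i)) //.
by rewrite (le_trans tL') // lerDr.
Qed.

End PolynomialApproximation.

(** * Sequences whose j-th difference is of size h^j *)

Section FiniteDifferences.
Variable R : realType.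
Implicit Types (u v : nat -> R) (p : {poly R}).

Definition fdiff j u : nat -> R := iter j (fun v n => v n.+1 - v n) u.

Lemma fdiffS j u n : fdiff j.+1 u n = fdiff j u n.+1 - fdiff j u n.
Proof. by []. Qed.

Lemma fdiffSr j u : fdiff j.+1 u = fdiff j (fun n => u n.+1 - u n).
Proof. exact: iterSr. Qed.

Lemma fdiff_add i j u : fdiff (i + j) u = fdiff i (fdiff j u).
Proof. exact: iterD. Qed.

Lemma fdiffB j u v n :
  fdiff j (fun l => u l - v l) n = fdiff j u n - fdiff j v n.
Proof. by elim: j n => [//|j IH] n; rewrite !fdiffS !IH; ring. Qed.

Lemma fdiffZ j a u n : fdiff j (fun l => a * u l) n = a * fdiff j u n.
Proof. by elim: j n => [//|j IH] n; rewrite !fdiffS !IH; ring. Qed.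

Lemma fdiff_shift j u m n :
  fdiff j (fun l => u (m + l)%N) n = fdiff j u (m + n)%N.
Proof. by elim: j n => [//|j IH] n; rewrite !fdiffS !IH addnS. Qed.

Lemma fdiff_bound j u (e : R) n :
  (forall l, (l <= j)%N -> `|u (n + l)%N| <= e) -> `|fdiff j u n| <= 2 ^+ j * e.
Proof.
elim: j n => [|j IH] n ue.
  by rewrite mul1r -[n]addn0 ue.
rewrite fdiffS (le_trans (ler_normB _ _)) // exprS -mulrA.
rewrite (_ : 2 * (2 ^+ j * e) = 2 ^+ j * e + 2 ^+ j * e); last by ring.
apply: lerD; apply: IH => l lj; first by rewrite addSnnS ue.
by rewrite ue // leqW.
Qed.

(** Translation keeps the leading coefficient. *)
Lemma size_poly_shift_sub k p :
  (size p <= k.+1)%N -> (size (p \Po ('X + 1) - p)%R <= k)%N.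
Proof.
move=> sp; have sX : size ('X + 1 : {poly R}) = 2 by rewrite -polyC1 size_XaddC.
have sc : size (p \Po ('X + 1)) = size p by rewrite size_comp_poly2.
apply/leq_sizeP => j kj; rewrite coefB.
have [pj|pj] := eqVneq (size p) j.+1; last first.
  have sj : (size p <= j)%N.
    by rewrite -ltnS ltn_neqAle pj (leq_trans sp).
  by rewrite !nth_default ?sc // subrr.
have -> : p`_j = lead_coef p by rewrite lead_coefE pj.
have -> : (p \Po ('X + 1))`_j = lead_coef (p \Po ('X + 1)).
  by rewrite lead_coefE sc pj.
have lX : lead_coef ('X + 1 : {poly R}) = 1.
  by rewrite -polyC1 lead_coefXaddC.
by rewrite lead_coef_comp ?sX // lX expr1n mulr1 subrr.
Qed.

Lemma fdiff_poly k p n : (size p <= k)%N -> fdiff k (fun l => p.[l%:R]) n = 0.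
Proof.
elim: k p => [|k IH] p sp.
  by rewrite (size_poly_leq0P p sp) /fdiff /= horner0.
rewrite fdiffSr -(IH _ (size_poly_shift_sub sp)).
congr (fdiff _ _ _); apply/funext => l.
by rewrite !hornerE horner_comp !hornerE natr1.
Qed.

Lemma newton_forward N u n l : (l < N)%N ->
  u (n + l)%N = \sum_(j < N) 'C(l, j)%:R * fdiff j u n.
Proof.
elim: l N n => [|l IH] [|N] n // lN.
  rewrite big_ord_recl big1 ?addr0 ?addn0 ?mul1r // => j _.
  by rewrite bin0n mul0r.
rewrite addnS -addSn (IH N.+1) 1?ltnW //.
have E (j : 'I_N.+1) : true -> 'C(l, j)%:R * fdiff j u n.+1 =
    'C(l, j)%:R * fdiff j.+1 u n + 'C(l, j)%:R * fdiff j u n.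
  by rewrite fdiffS -mulrDr subrK.
rewrite (eq_bigr _ E) big_split /= big_ord_recr /= bin_small // mul0r addr0.
rewrite [X in _ + X]big_ord_recl addrCA bin0 -big_split.
rewrite [RHS]big_ord_recl bin0 /=.
congr (_ + _); apply: eq_bigr => j _.
by rewrite /bump /= add1n binS natrD mulrDl addrC.
Qed.

(** The falling factorial divided by [j!], as a polynomial in its upper
    argument. *)
Lemma exists_bin_poly j : exists B : {poly R},
  (size B <= j.+1)%N /\ forall l : nat, B.[l%:R] = 'C(l, j)%:R.
Proof.
suff [B [sB HB]] : exists B : {poly R},
    (size B <= j.+1)%N /\ forall l : nat, B.[l%:R] = (l ^_ j)%:R.
  exists (j`!%:R^-1 *: B); split=> [|l].
    exact: leq_trans (size_scale_leq _ _) sB.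
  by rewrite hornerZ HB -bin_ffact natrM mulrCA mulVf ?mulr1.
elim: j => [|j [B [sB HB]]].
  by exists 1; rewrite size_poly1; split=> // l; rewrite hornerC ffactn0.
exists (B * ('X - j%:R%:P)); split=> [|l].
  by rewrite (leq_trans (size_polyMleq _ _)) // size_XsubC addn2 /= ltnS.
rewrite hornerM HB hornerXsubC ffactnSr natrM.
have [jl|lj] := leqP j l; first by rewrite natrB.
by rewrite ffact_small // !mul0r.
Qed.

End FiniteDifferences.

Section SmoothSequences.
Variables (R : realType) (T : Type) (h : T -> R).
Hypothesis h01 : forall tau, 0 < h tau <= 1.
Implicit Types (u v w : T -> nat -> R).

(** Differences of order beyond [k] are only required to be O(h^k), which
    follows from order [k]; quantifying over all [j] lets Newton's formula use
    arbitrarily many nodes. *)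
Definition smoothseq k u := forall j, exists C, forall tau n,
  `|fdiff j (u tau) n| <= C * h tau ^+ minn j k.

(** The curve of index [(tau, n)] passes through the [m.+1] values that start
    at time [n]. *)
Definition interpolates m (phi : T * nat -> R -> R) u :=
  forall tau n l, (l <= m)%N -> phi (tau, n) l%:R = u tau (n + l)%N.

Let h' (i : T * nat) := h i.1.
Let h'01 i : 0 < h' i <= 1. Proof. exact: h01. Qed.

(** Newton's forward formula: the coefficient of the binomial polynomial of
    degree [j] is the [j]-th difference, so [hsmooth_scaled_poly] applies to
    each term. *)
Lemma smoothseq_interp k m u : smoothseq k u ->
  exists2 phi,
    hsmooth (fun i : T * nat => h i.1) m k phi & interpolates m phi u.
Proof.
move=> su; have [B HB] := choice (@exists_bin_poly R).
exists (fun i t => \sum_(j < m.+1) fdiff j (u i.1) i.2 * (B j).[t]).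
  apply: hsmooth_sum => j.
  apply: (@hsmooth_scaled_poly R _ h' m h'01 k (minn j k)).
    by have [C uC] := su j; exists C => -[].
  have [sB _] := HB j; have [_|_] := leqP j k; first by rewrite sB.
  by rewrite leqnn orbT.
move=> tau n l lm; rewrite (newton_forward (N := m.+1)) //.
by apply: eq_bigr => j _; have [_ ->] := HB j; rewrite mulrC.
Qed.

(** Up to O(h^j) the curve is a polynomial of degree less than [j], whose [j]-th
    difference vanishes. *)
Lemma interp_smoothseq k m phi u : (k <= m)%N ->
  hsmooth (fun i : T * nat => h i.1) m k phi -> interpolates m phi u ->
  smoothseq k u.
Proof.
move=> km sphi iphi.
have lo j : (j <= k)%N -> exists C, forall tau n,
    `|fdiff j (u tau) n| <= C * h tau ^+ j.
  move=> jk; have {}sphi : hsmooth (fun i : T * nat => h i.1) m j phi.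
    by move: sphi; rewrite -(subnK jk); elim: (k - j)%N => [|d IH] // /hsmoothW.
  have [p sp [C HC]] := hsmooth_poly_approx h'01 sphi.
  exists (2 ^+ j * C) => tau n.
  have -> : fdiff j (u tau) n =
      fdiff j (fun l => u tau (n + l)%N - (p (tau, n)).[l%:R]) 0.
    by rewrite fdiffB fdiff_poly // subr0 fdiff_shift addn0.
  rewrite -mulrA; apply: fdiff_bound => l lj; rewrite add0n.
  have lm : (l <= m)%N by rewrite (leq_trans lj) // (leq_trans jk).
  rewrite -(iphi tau n l lm); have [] // := HC (tau, n) l%:R.
  by rewrite ler0n ler_nat.
move=> j; rewrite /minn; case: ltnP => [jk|kj]; first by apply: lo; exact: ltnW.
have [C HC] := lo k (leqnn k).
exists (2 ^+ (j - k) * C) => tau n; rewrite -{1}(subnK kj) fdiff_add -mulrA.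
by apply: fdiff_bound => l _; apply: HC.
Qed.

End SmoothSequences.

Section SmoothSequenceClosure.
Variables (R : realType) (T : Type) (h : T -> R).
Hypothesis h01 : forall tau, 0 < h tau <= 1.
Implicit Types (u v w : T -> nat -> R).

Lemma smoothseqB k u v : smoothseq h k u -> smoothseq h k v ->
  smoothseq h k (fun tau n => u tau n - v tau n).
Proof.
move=> /(smoothseq_interp h01 k)[f sf iu] /(smoothseq_interp h01 k)[g sg iv].
apply: (interp_smoothseq h01 (leqnn k) (hsmoothB sf sg)) => tau n l lk.
by rewrite iu // iv.
Qed.

Lemma smoothseqM k u v : smoothseq h k u -> smoothseq h k v ->
  smoothseq h k (fun tau n => u tau n * v tau n).
Proof.
move=> /(smoothseq_interp h01 k)[f sf iu] /(smoothseq_interp h01 k)[g sg iv].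
apply: (interp_smoothseq h01 (leqnn k) (hsmoothM sf sg)) => tau n l lk.
by rewrite iu // iv.
Qed.

Lemma smoothseqZ k (a : R) u : smoothseq h k u ->
  smoothseq h k (fun tau n => a * u tau n).
Proof.
move=> /(smoothseq_interp h01 k)[f sf iu].
apply: (interp_smoothseq h01 (leqnn k) (hsmoothZ a sf)) => tau n l lk.
by rewrite iu.
Qed.

Lemma smoothseqD k u v : smoothseq h k u -> smoothseq h k v ->
  smoothseq h k (fun tau n => u tau n + v tau n).
Proof.
move=> /(smoothseq_interp h01 k)[f sf iu] /(smoothseq_interp h01 k)[g sg iv].
apply: (interp_smoothseq h01 (leqnn k) (hsmoothD sf sg)) => tau n l lk.
by rewrite iu // iv.
Qed.

Lemma smoothseq_sum k m (u : 'I_m -> T -> nat -> R) :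
  (forall j, smoothseq h k (u j)) ->
  smoothseq h k (fun tau n => \sum_j u j tau n).
Proof.
move=> su.
have /choice[f Hf] : forall j, exists f,
    hsmooth (fun i : T * nat => h i.1) k k f /\ interpolates k f (u j).
  by move=> j; have [f ? ?] := smoothseq_interp h01 k (su j); exists f.
apply: (interp_smoothseq h01 (leqnn k) (hsmooth_sum (fun j => (Hf j).1))).
by move=> tau n l lk; apply: eq_bigr => j _; rewrite (Hf j).2.
Qed.

Lemma smoothseq_comp k (f : 'rV[R]_3 -> R^o) (u : T -> nat -> 'rV[R]_3) :
  smooth f -> (forall j, smoothseq h k (fun tau n => u tau n 0 j)) ->
  smoothseq h k (fun tau n => f (u tau n)).
Proof.
move=> sf su.
have /choice[g Hg] : forall j, exists g,
    hsmooth (fun i : T * nat => h i.1) k k g /\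
    interpolates k g (fun tau n => u tau n 0 j).
  by move=> j; have [g ? ?] := smoothseq_interp h01 k (su j); exists g.
apply: (interp_smoothseq h01 (leqnn k) (hsmooth_comp sf (fun j => (Hg j).1))).
move=> tau n l lk; congr (f _); apply/rowP => j.
by rewrite mxE (Hg j).2.
Qed.

Lemma smoothseq_shift k u : smoothseq h k u ->
  smoothseq h k (fun tau n => u tau n.+1).
Proof.
move=> su j; have [C uC] := su j; exists C => tau n.
by rewrite (fdiff_shift j (u tau) 1 n) uC.
Qed.

Lemma smoothseq0 u : (exists C, forall tau n, `|u tau n| <= C) ->
  smoothseq h 0 u.
Proof.
move=> [C uC] j; exists (2 ^+ j * C) => tau n.
by rewrite minn0 mulr1; apply: fdiff_bound => l _; apply: uC.
Qed.

Lemma smoothseq_bounded k u : smoothseq h k u ->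
  exists C, forall tau n, `|u tau n| <= C.
Proof.
move=> /(_ 0%N)[C uC]; exists C => tau n.
by have := uC tau n; rewrite min0n mulr1.
Qed.

(** The step that gains an order in the regularity induction for the numerical
    solution. *)
Lemma smoothseqS k u w : smoothseq h k u -> smoothseq h k w ->
  (forall tau n, u tau n.+1 - u tau n = h tau * w tau n) ->
  smoothseq h k.+1 u.
Proof.
move=> su sw uw [|j]; first by have := su 0%N; rewrite !min0n.
have [C wC] := sw j; exists C => tau n.
rewrite fdiffSr (_ : (fun _ => _) = (fun n => h tau * w tau n)); last first.
  by apply/funext => l; rewrite uw.
have h0 : 0 < h tau by case/andP: (h01 tau).
by rewrite fdiffZ normrM gtr0_norm // minnSS exprS mulrCA ler_wpM2l // ltW.
Qed.

Lemma smoothseq_lipschitz u : smoothseq h 1 u ->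
  forall i, exists C, forall tau n, `|u tau (n + i)%N - u tau n| <= C * h tau.
Proof.
move=> su; elim=> [|i [C HC]].
  by exists 0 => tau n; rewrite addn0 subrr normr0 mul0r.
have [D HD] := su 1%N; exists (D + C) => tau n.
rewrite addnS -(subrKA (u tau (n + i)%N)) (le_trans (ler_normD _ _)) //.
by rewrite mulrDl lerD // HD.
Qed.

End SmoothSequenceClosure.

(** * Numerical differentiation formulas *)

Section DerivativeRules.
Variables (R : realType) (m c k : nat) (lam : (nat -> R) -> R).

(** [lam] is a linear differentiation formula at node [c] with nodes [0, .., m],
    exact on polynomials of degree less than [k].  The bound also says that
    [lam] only sees the first [m.+1] values. *)
Definition derivative_rule :=
  [/\ forall u v, lam (fun l => u l - v l) = lam u - lam v,
      exists B : R, forall u (e : R), (forall l, (l <= m)%N -> `|u l| <= e) ->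
        `|lam u| <= B * e &
      forall p : {poly R}, (size p <= k)%N ->
        lam (fun l => p.[l%:R]) = p^`().[c%:R]].

(** Replacing the curve by its polynomial approximation costs O(h^k) both in the
    formula and in the derivative. *)
Lemma derivative_rule_error (I : Type) (h : I -> R) phi :
  (forall i, 0 < h i <= 1) -> derivative_rule -> (0 < k)%N -> (c <= m)%N ->
  hsmooth h m k phi ->
  exists C, forall i,
    `|lam (fun l => phi i l%:R) - (phi i)^`()%classic c%:R| <= C * h i ^+ k.
Proof.
move=> h01 [lamB [B lam_bound] lam_poly] k0 cm /(hsmooth_poly_approx h01).
move=> [p sp [C HC]]; exists (B * C + C) => i.
have -> : lam (fun l => phi i l%:R) - (phi i)^`()%classic c%:R =
    lam (fun l => phi i l%:R - (p i).[l%:R]) -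
    ((phi i)^`()%classic c%:R - (p i)^`().[c%:R]).
  by rewrite lamB lam_poly //; ring.
have node l : (l <= m)%N -> 0 <= (l%:R : R) <= m%:R.
  by move=> lm; apply/andP; split; rewrite ?ler_nat // ler0n.
rewrite (le_trans (ler_normB _ _)) // mulrDl lerD //; last first.
  by have [_ ->] := HC i _ (node c cm).
rewrite -mulrA; apply: lam_bound => l lm.
by have [] := HC i _ (node l lm).
Qed.

End DerivativeRules.

Section DifferentiationFormulas.
Variable R : realType.

Lemma forward_difference_rule :
  derivative_rule 1 0 2 (fun u : nat -> R => u 1%N - u 0%N).
Proof.
split=> [u v|| q sq]; first by ring.
  exists 2 => u e ue; rewrite (le_trans (ler_normB _ _)) //.
  by rewrite mulr_natl mulr2n lerD ?ue.
rewrite !(horner_coef_wide _ sq) !big_ord_recl !big_ord0 /=.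
rewrite (@horner_coef_wide _ 1 q^`()).
  by rewrite big_ord1 coef_deriv /bump /=; ring.
by rewrite (leq_trans (size_poly _ _)) // -subn1 leq_subLR.
Qed.

Definition central_difference (beta : nat -> R) r (u : nat -> R) : R :=
  \sum_(j < r) beta j * (u (r + j.+1)%N - u (r - j.+1)%N).

(** The conditions say that the central formula is exact on odd monomials.  In
    the unknowns weight times node they form a Vandermonde system in the squares
    of the nodes, which are distinct. *)
Lemma exists_central_weights r : exists beta : nat -> R,
  forall i, (i < r)%N ->
    2 * \sum_(j < r) beta j * j.+1%:R ^+ i.*2.+1 = (i == 0%N)%:R.
Proof.
case: r => [|r]; first by exists (fun=> 0).
pose a : 'rV[R]_r.+1 := \row_j (j.+1%:R ^+ 2).
pose V := Vandermonde r.+1 a.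
have uV : V \in unitmx.
  rewrite unitmxE det_Vandermonde unitfE.
  apply/prodf_neq0 => i _; apply/prodf_neq0 => j ij.
  rewrite !mxE subr_eq0 -!natrX eqr_nat gt_eqF //.
  by rewrite ltEnat /= ltn_sqr ltnS.
pose g : 'cV[R]_r.+1 := invmx V *m (2^-1 *: delta_mx 0 0).
exists (fun j => g (inord j) 0 / j.+1%:R) => i ir.
have := congr1 (fun M : 'cV[R]_r.+1 => M (Ordinal ir) 0)
  (mulKVmx uV (2^-1 *: delta_mx 0 0)).
rewrite /= -/g !mxE eqxx andbT -[Ordinal ir == 0]/(i == 0%N) => E.
have -> : ((i == 0%N)%:R : R) = 2 * (2^-1 * (i == 0%N)%:R).
  by rewrite mulrA divff ?mul1r // pnatr_eq0.
rewrite -E; congr (2 * _); apply: eq_bigr => j _.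
rewrite !mxE inord_val exprS mulrA divfK ?pnatr_eq0 // mulrC.
by rewrite -exprM mul2n.
Qed.

(** After recentring at [r], even monomials cancel by symmetry and odd ones are
    handled by the choice of the weights. *)
Lemma central_difference_rule r (beta : nat -> R) : (0 < r)%N ->
  (forall i, (i < r)%N ->
    2 * \sum_(j < r) beta j * j.+1%:R ^+ i.*2.+1 = (i == 0%N)%:R) ->
  derivative_rule r.*2 r r.*2.+1 (central_difference beta r).
Proof.
move=> r0 Hb; rewrite /central_difference; split=> [u v||q sq].
- by rewrite -sumrB; apply: eq_bigr => j _; ring.
- exists (\sum_(j < r) `|beta j| * 2) => u e ue.
  rewrite (le_trans (ler_norm_sum _ _ _)) // mulr_suml; apply: ler_sum => j _.
  rewrite normrM -mulrA ler_wpM2l // (le_trans (ler_normB _ _)) //.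
  rewrite mulr_natl mulr2n lerD // ue //.
    by rewrite -addnn leq_add2l.
  by rewrite (leq_trans (leq_subr _ _)) // -addnn leq_addr.
pose p := q \Po ('X + r%:R%:P).
have sp : (size p <= r.*2.+1)%N by rewrite size_comp_poly2 // size_XaddC.
have pE s : p.[s] = q.[s + r%:R] by rewrite horner_comp !hornerE.
have -> : q^`().[r%:R] = p`_1.
  have -> : p`_1 = p^`().[0] by rewrite horner_coef0 coef_deriv.
  rewrite deriv_comp derivD derivX derivC addr0 mulr1 horner_comp.
  by rewrite hornerD hornerX hornerC add0r.
have E (j : 'I_r) : true -> beta j * (q.[(r + j.+1)%:R] - q.[(r - j.+1)%:R]) =
    \sum_(i < r.*2.+1) p`_i * (beta j * (j.+1%:R ^+ i - (- j.+1%:R) ^+ i)).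
  move=> _; have -> : (r + j.+1)%:R = j.+1%:R + r%:R :> R.
    by rewrite natrD addrC.
  have -> : (r - j.+1)%:R = - j.+1%:R + r%:R :> R.
    by rewrite natrB ?ltn_ord // addrC.
  rewrite -!pE !(horner_coef_wide _ sp) -sumrB mulr_sumr; apply: eq_bigr => i _.
  by ring.
rewrite (eq_bigr _ E) exchange_big /=.
have one : (1 < r.*2.+1)%N by rewrite ltnS double_gt0.
rewrite (bigD1 (Ordinal one)) //= [X in _ + X]big1 ?addr0 => [|i i1].
  rewrite -mulr_sumr -[RHS]mulr1; congr (_ * _).
  rewrite -[RHS](Hb 0%N r0) mulr_sumr; apply: eq_bigr => j _.
  by rewrite expr1 opprK; ring.
rewrite -mulr_sumr; have [io|ie] := boolP (odd i); last first.
  rewrite big1 ?mulr0 // => j _.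
  by rewrite exprNn -signr_odd (negPf ie) expr0 mul1r subrr mulr0.
have iE : i = i./2.*2.+1 :> nat by rewrite -[LHS]odd_double_half io.
have i0 : i./2 != 0%N by apply: contra i1 => /eqP i2; rewrite -val_eqE /= iE i2.
have ir : (i./2 < r)%N.
  by have := ltn_ord i; rewrite ltnS [X in (X <= _)%N -> _]iE ltn_double.
have := Hb _ ir; rewrite (negPf i0) -iE mulr0n => Hi.
rewrite (_ : \sum_(j < r) _ = 0) ?mulr0 // -[RHS]Hi mulr_sumr.
apply: eq_bigr => j _.
by rewrite exprNn -signr_odd io expr1 mulN1r opprK; ring.
Qed.

End DifferentiationFormulas.

(** * Energy along the trapezoidal rule *)

Lemma energyE (R : realType) (U : 'rV[R]_3 -> R^o) (x v : 'rV[R]_3) :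
  energy U x v = 2^-1 * (\sum_j v 0 j * v 0 j) + U x.
Proof.
rewrite /energy /enorm sqr_sqrtr.
  by under eq_bigr do rewrite expr2.
by apply: sumr_ge0 => i _; exact: sqr_ge0.
Qed.

(** In canonical coordinates [(Y, Q)] this is dH = p dQ - G dY: the Jacobian of
    [A], which enters through p = Q - A(Y), is absorbed in the force G. *)
Lemma is_derive_energy (R : realType) (A : 'rV[R]_3 -> 'rV[R]_3)
    (U : 'rV[R]_3 -> R^o) (Y Q : 'I_3 -> R -> R) (dY dQ : 'I_3 -> R) (t : R)
    (X := fun s => \row_j Y j s) (P := fun j s => Q j s - A (X s) 0 j) :
  smooth A -> smooth U ->
  (forall j, is_derive t 1 (Y j) (dY j)) ->
  (forall j, is_derive t 1 (Q j) (dQ j)) ->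
  is_derive t 1 (fun s => 2^-1 * (\sum_j P j s * P j s) + U (X s) : R)
    (\sum_i (P i t * dQ i -
       (\sum_j P j t * partial i (fun x => A x 0 j : R^o) (X t)
         - partial i U (X t)) * dY i)).
Proof.
move=> sA sU dy dq.
have dU := @is_derive_curve R U Y dY t (sU 1%N) dy.
have dP j : is_derive t 1 (P j)
    (dQ j - \sum_i dY i * partial i (fun x => A x 0 j : R^o) (X t)).
  have := @is_derive_curve R _ Y dY t (smooth_coord j sA 1%N) dy.
  by move=> ?; exact: is_deriveB.
have dPP j := is_deriveM (dP j) (dP j).
have dS := is_derive_sum dPP.
have dS2 := is_deriveZ 2^-1 dS.
have := is_deriveD dS2 dU.
have -> : 2^-1 \*: (\sum_(j < 3) (P j * P j)) + (fun s => U (X s) : R) =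
   (fun s => 2^-1 * (\sum_j P j s * P j s) + U (X s) : R).
  by apply/funext => s; rewrite /= fctE /= fct_sumE.
move=> H; apply: is_derive_eq H _.
rewrite scaler_sumr.
pose a j i := partial i (fun x => A x 0 j : R^o) (X t).
have -> : \sum_j 2^-1 *: (P j t *: (dQ j - \sum_i dY i * a j i) +
      P j t *: (dQ j - \sum_i dY i * a j i)) =
    \sum_j P j t * dQ j - \sum_i (\sum_j P j t * a j i) * dY i.
  under [X in _ = _ - X]eq_bigr do rewrite mulr_suml.
  rewrite exchange_big -sumrB /=; apply: eq_bigr => j _.
  have -> : \sum_i P j t * a j i * dY i = P j t * \sum_i dY i * a j i.
    by rewrite mulr_sumr; apply: eq_bigr => i _; ring.
  by rewrite /GRing.scale /=; field.
rewrite -sumrB -big_split /=; apply: eq_bigr => i _; rewrite -/(a _ _); ring.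
Qed.

(** A sum of long-range increments telescopes from either side: exchanging the
    roles of [N] and [i] leaves only boundary values. *)
Lemma sum_shift_sub (R : zmodType) (v : nat -> R) i N :
  \sum_(n < N) (v (n + i)%N - v n) = \sum_(k < i) (v (N + k)%N - v k).
Proof.
elim: i => [|i IH].
  by rewrite big_ord0 big1 // => n _; rewrite addn0 subrr.
rewrite big_ord_recr /= -IH.
have -> : v (N + i)%N - v i = \sum_(n < N) (v (n + i).+1 - v (n + i)%N).
  by rewrite -(big_mkord xpredT (fun n => v (n + i).+1 - v (n + i)%N))
    (telescope_sumr (fun n => v (n + i)%N)).
by rewrite -big_split /=; apply: eq_bigr => n _; rewrite addnS addrC subrKA.
Qed.

Section TrapezoidalRule.
Variables (R : realType) (A : 'rV[R]_3 -> 'rV[R]_3) (U : 'rV[R]_3 -> R^o).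
Hypotheses (sA : smooth A) (sU : smooth U).
Variables (T : Type) (h : T -> R) (y p : T -> nat -> 'rV[R]_3).
Hypothesis h01 : forall tau, 0 < h tau <= 1.

(** The canonical momentum, whose increments obey the trapezoidal rule. *)
Definition momentum i tau n : R := p tau n 0 i + A (y tau n) 0 i.

Definition force i tau n : R :=
  \sum_j p tau n 0 j * partial i (fun x => A x 0 j : R^o) (y tau n)
  - partial i U (y tau n).

Let H tau n := energy U (y tau n) (p tau n).

Hypothesis y_step : forall i tau n,
  y tau n.+1 0 i - y tau n 0 i =
  h tau * (2^-1 * (p tau n 0 i + p tau n.+1 0 i)).
Hypothesis q_step : forall i tau n,
  momentum i tau n.+1 - momentum i tau n =
  h tau * (2^-1 * (force i tau n + force i tau n.+1)).
Hypothesis y_bounded : forall i, exists C, forall tau n, `|y tau n 0 i| <= C.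
Hypothesis p_bounded : forall i, exists C, forall tau n, `|p tau n 0 i| <= C.

Let smooth_a j : smooth (fun x => A x 0 j : R^o).
Proof. exact: smooth_coord. Qed.

Lemma velocity_smoothseq k i :
  (forall i, smoothseq h k (fun tau n => y tau n 0 i)) ->
  smoothseq h k (momentum i) -> smoothseq h k (fun tau n => p tau n 0 i).
Proof.
move=> sy sq.
have := smoothseqB h01 sq (smoothseq_comp h01 (smooth_a i) sy).
by under eq_fun do under eq_fun do rewrite /momentum addrK.
Qed.

Lemma force_smoothseq k i :
  (forall i, smoothseq h k (fun tau n => y tau n 0 i)) ->
  (forall i, smoothseq h k (fun tau n => p tau n 0 i)) ->
  smoothseq h k (force i).
Proof.
move=> sy sp; apply: smoothseqB => //.
  apply: smoothseq_sum => // j; apply: smoothseqM => //.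
  by apply: smoothseq_comp => //; exact: smooth_partial.
by apply: smoothseq_comp => //; exact: smooth_partial.
Qed.

(** Regularity induction: velocity and force are smooth functions of (y, q) and
    inherit order [k], and one trapezoidal step turns it into order [k.+1]. *)
Lemma trapezoidal_smoothseq k :
  (forall i, smoothseq h k (fun tau n => y tau n 0 i)) /\
  (forall i, smoothseq h k (momentum i)).
Proof.
elim: k => [|k [sy sq]].
  have sy i : smoothseq h 0 (fun tau n => y tau n 0 i) by exact: smoothseq0.
  split=> // i; apply: smoothseqD => //; first exact: smoothseq0.
  exact: (smoothseq_comp h01 (smooth_a i) sy).
have sp i := velocity_smoothseq sy (sq i).
have sG i := force_smoothseq i sy sp.
split=> i.
  apply: (smoothseqS h01 (sy i) _ (y_step i)).
  apply: smoothseqZ => //; apply: smoothseqD => //.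
  exact: (@smoothseq_shift R T h k (fun tau n => p tau n 0 i)).
apply: (smoothseqS h01 (sq i) _ (q_step i)).
apply: smoothseqZ => //; apply: smoothseqD => //.
exact: smoothseq_shift.
Qed.

Lemma y_smooth k i : smoothseq h k (fun tau n => y tau n 0 i).
Proof. exact: (trapezoidal_smoothseq k).1. Qed.

Lemma q_smooth k i : smoothseq h k (momentum i).
Proof. exact: (trapezoidal_smoothseq k).2. Qed.

Lemma p_smooth k i : smoothseq h k (fun tau n => p tau n 0 i).
Proof. exact: velocity_smoothseq (y_smooth k) (q_smooth k i). Qed.

Lemma force_smooth k i : smoothseq h k (force i).
Proof. exact: force_smoothseq (y_smooth k) (p_smooth k). Qed.

(** The chain rule holds for the interpolating curves, and [lam] is within
    O(h^k) of the derivative on the energy as well as on each coordinate. *)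
Lemma energy_rule m c k lam : (0 < k)%N -> (c <= m)%N ->
  derivative_rule m c k lam ->
  exists C, forall tau n,
    `|lam (fun l => H tau (n + l)%N) -
      \sum_i (p tau (n + c)%N 0 i * lam (fun l => momentum i tau (n + l)%N)
            - force i tau (n + c)%N * lam (fun l => y tau (n + l)%N 0 i))|
    <= C * h tau ^+ k.
Proof.
move=> k0 cm rule.
pose h' (i : T * nat) := h i.1.
have h'01 i : 0 < h' i <= 1 by exact: h01.
have /choice[Y HY] : forall i, exists f, hsmooth h' m k f /\
    interpolates m f (fun tau n => y tau n 0 i).
  by move=> i; have [f ? ?] := smoothseq_interp h01 m (y_smooth k i); exists f.
have /choice[Q HQ] : forall i, exists f, hsmooth h' m k f /\
    interpolates m f (momentum i).
  by move=> i; have [f ? ?] := smoothseq_interp h01 m (q_smooth k i); exists f.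
pose X a t := \row_j Y j a t.
pose P j a t := Q j a t - A (X a t) 0 j.
pose E a t := 2^-1 * (\sum_j P j a t * P j a t) + U (X a t).
have Xl tau n l : (l <= m)%N -> X (tau, n) l%:R = y tau (n + l)%N.
  by move=> lm; apply/rowP => j; rewrite mxE (HY j).2.
have Pl j tau n l : (l <= m)%N -> P j (tau, n) l%:R = p tau (n + l)%N 0 j.
  by move=> lm; rewrite /P Xl // (HQ j).2 // /momentum addrK.
have El tau n l : (l <= m)%N -> E (tau, n) l%:R = H tau (n + l)%N.
  move=> lm; rewrite /E /H energyE Xl //; congr (_ * _ + _).
  by apply: eq_bigr => j _; rewrite Pl.
have sP j : hsmooth h' m k (P j).
  apply: hsmoothB; first exact: (HQ j).1.
  exact: (hsmooth_comp (smooth_a j) (fun j => (HY j).1)).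
have sE : hsmooth h' m k E.
  apply: hsmoothD; last exact: (hsmooth_comp sU (fun j => (HY j).1)).
  by apply: hsmoothZ; apply: hsmooth_sum => j; exact: hsmoothM.
have [CE HE] := derivative_rule_error h'01 rule k0 cm sE.
have /choice[CY HCY] j := derivative_rule_error h'01 rule k0 cm (HY j).1.
have /choice[CQ HCQ] j := derivative_rule_error h'01 rule k0 cm (HQ j).1.
have /choice[Bp Hp] j := smoothseq_bounded (p_smooth 0 j).
have /choice[BG HG] j := smoothseq_bounded (force_smooth 0 j).
exists (CE + \sum_i (Bp i * CQ i + BG i * CY i)) => tau n.
have lam_ext (u v : nat -> R) :
    (forall l, (l <= m)%N -> u l = v l) -> lam u = lam v.
  move=> uv; have [lamB [B lam_bound] _] := rule; apply/eqP.
  rewrite -subr_eq0 -lamB -normr_le0 -(mulr0 B); apply: lam_bound => l lm.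
  by rewrite uv // subrr normr0.
have derivable_hs f : hsmooth h' m k f -> forall a (t : R), derivable (f a) t 1.
  case: (k) k0 => // k' _ [_ [psi df _]] a t.
  exact: (@ex_derive _ _ _ _ _ _ _ (df a t)).
have dd f : hsmooth h' m k f ->
    is_derive (c%:R : R) 1 (f (tau, n)) ((f (tau, n))^`()%classic c%:R).
  by move=> sf; rewrite derive1E; apply: derivableP; exact: derivable_hs.
have dE := @is_derive_energy R A U
  (fun j => Y j (tau, n)) (fun j => Q j (tau, n)) _ _ c%:R
  sA sU (fun j => dd _ (HY j).1) (fun j => dd _ (HQ j).1).
have {}dE := @derive_val _ _ _ _ _ _ _ dE.
move: dE; rewrite -derive1E -[(fun s : R => _)]/(E (tau, n)) => dE.
have forceE i :
    \sum_j P j (tau, n) c%:R *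
      partial i (fun x => A x 0 j : R^o) (X (tau, n) c%:R)
    - partial i U (X (tau, n) c%:R) = force i tau (n + c)%N.
  by rewrite /force Xl //; congr (_ - _); apply: eq_bigr => j _; rewrite Pl.
set DE := (E (tau, n))^`()%classic c%:R in dE.
pose DQ i := (Q i (tau, n))^`()%classic c%:R.
pose DY i := (Y i (tau, n))^`()%classic c%:R.
have {}dE : DE =
    \sum_i (p tau (n + c)%N 0 i * DQ i - force i tau (n + c)%N * DY i).
  rewrite dE; apply: eq_bigr => i _; congr (_ * _ - _ * _); last exact: forceE.
  exact: (Pl i).
have -> : lam (fun l => H tau (n + l)%N) = lam (fun l => E (tau, n) l%:R).
  by apply: lam_ext => l lm; rewrite El.
have lQ i : lam (fun l => momentum i tau (n + l)%N) =
    lam (fun l => Q i (tau, n) l%:R).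
  by apply: lam_ext => l lm; rewrite (HQ i).2.
have lY i : lam (fun l => y tau (n + l)%N 0 i) =
    lam (fun l => Y i (tau, n) l%:R).
  by apply: lam_ext => l lm; rewrite (HY i).2.
rewrite (_ : _ - _ = (lam (fun l => E (tau, n) l%:R) - DE) -
   \sum_i (p tau (n + c)%N 0 i * (lam (fun l => Q i (tau, n) l%:R) - DQ i)
     - force i tau (n + c)%N * (lam (fun l => Y i (tau, n) l%:R) - DY i)));
  last first.
  rewrite {}dE -[RHS]addrA -opprD -big_split /=; congr (_ - _).
  by apply: eq_bigr => i _; rewrite lQ lY; ring.
rewrite mulrDl (le_trans (ler_normB _ _)) // lerD //.
rewrite mulr_suml (le_trans (ler_norm_sum _ _ _)) //; apply: ler_sum => i _.
rewrite (le_trans (ler_normB _ _)) // !normrM mulrDl -!mulrA.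
by apply: lerD; apply: ler_pM.
Qed.

(** The symplectic form of the Hamiltonian vector field (p, G) at times [m] and
    [l]. *)
Definition field_pairing tau m l : R :=
  \sum_i (p tau m 0 i * force i tau l - force i tau m * p tau l 0 i).

(** The symplectic form of the vector field at time [m] and the state (y, q) at
    time [l].  The differential of H is the pairing with the vector field, so
    increments of this quantity for [l] near [m] approximate those of H. *)
Definition state_pairing tau m l : R :=
  \sum_i (p tau m 0 i * momentum i tau l - force i tau m * y tau l 0 i).

Lemma field_pairing_anti tau m l :
  field_pairing tau m l = - field_pairing tau l m.
Proof. by rewrite -sumrN; apply: eq_bigr => i _; ring. Qed.

Lemma state_pairing_step tau m l :
  state_pairing tau m l.+1 - state_pairing tau m l =
  h tau / 2 * (field_pairing tau m l + field_pairing tau m l.+1).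
Proof.
rewrite -big_split mulr_sumr -sumrB; apply: eq_bigr => i _ /=.
rewrite -[momentum i tau l.+1](subrK (momentum i tau l)) q_step.
by rewrite -[y tau l.+1 0 i](subrK (y tau l 0 i)) y_step; field.
Qed.

(** The symmetry of the trapezoidal rule and of the central formula meets the
    antisymmetry of the form: the right-hand side consists of increments of the
    functions c |-> [field_pairing tau c (c + i)]. *)
Lemma state_pairing_central tau c j : (j <= c)%N ->
  state_pairing tau c (c + j) - state_pairing tau c (c - j) =
  h tau / 2 * \sum_(i < j)
    ((field_pairing tau c (c + i) - field_pairing tau (c - i) c) +
     (field_pairing tau c (c + i.+1) - field_pairing tau (c - i.+1) c)).
Proof.
elim: j => [|j IH] jc; first by rewrite big_ord0 addn0 subn0 subrr mulr0.
rewrite big_ord_recr mulrDr /= -IH; last exact: ltnW.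
rewrite addnS (field_pairing_anti tau (c - j)).
rewrite (field_pairing_anti tau (c - j.+1)).
have := state_pairing_step tau c (c + j).
have := state_pairing_step tau c (c - j.+1).
rewrite subnSK // => E1 E2.
have -> : state_pairing tau c (c + j).+1 = state_pairing tau c (c + j) +
   h tau / 2 * (field_pairing tau c (c + j) + field_pairing tau c (c + j).+1).
  by rewrite -E2 addrC subrK.
have -> : state_pairing tau c (c - j.+1) = state_pairing tau c (c - j) -
   h tau / 2 * (field_pairing tau c (c - j.+1) + field_pairing tau c (c - j)).
  by rewrite -E1 opprB addrC subrK.
ring.
Qed.

(** The pairing of a vector with itself vanishes and the vector field moves by
    O(h) in [i] steps. *)
Lemma field_pairing_bound i : exists C, forall tau m,
  `|field_pairing tau m (m + i)| <= C * h tau.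
Proof.
have /choice[Bp Hp] j := smoothseq_bounded (p_smooth 0 j).
have /choice[BG HG] j := smoothseq_bounded (force_smooth 0 j).
have /choice[Lp HLp] j := smoothseq_lipschitz (p_smooth 1 j) i.
have /choice[LG HLG] j := smoothseq_lipschitz (force_smooth 1 j) i.
exists (\sum_j (Bp j * LG j + BG j * Lp j)) => tau m.
rewrite (_ : field_pairing _ _ _ = \sum_j
  (p tau m 0 j * (force j tau (m + i)%N - force j tau m) -
   force j tau m * (p tau (m + i)%N 0 j - p tau m 0 j))); last first.
  by apply: eq_bigr => j _; ring.
rewrite mulr_suml (le_trans (ler_norm_sum _ _ _)) //; apply: ler_sum => j _.
rewrite (le_trans (ler_normB _ _)) // !normrM mulrDl -!mulrA.
by apply: lerD; apply: ler_pM.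
Qed.

Lemma sum_field_pairing_bound i s : exists C, forall tau N,
  `|\sum_(n < N) (field_pairing tau (n + s + i) (n + s + i + i) -
                  field_pairing tau (n + s) (n + s + i))| <= C * h tau.
Proof.
have [C HC] := field_pairing_bound i.
exists (2 * C *+ i) => tau N.
pose v n := field_pairing tau (n + s) (n + s + i).
have -> : \sum_(n < N) (field_pairing tau (n + s + i) (n + s + i + i) -
     field_pairing tau (n + s) (n + s + i)) = \sum_(n < N) (v (n + i)%N - v n).
  by apply: eq_bigr => n _; rewrite /v -(addnAC n s i).
rewrite sum_shift_sub (le_trans (ler_norm_sum _ _ _)) //.
have -> : (2 * C *+ i) * h tau = \sum_(k < i) (2 * C * h tau).
  by rewrite sumr_const card_ord mulrnAl.
apply: ler_sum => k _.
rewrite (le_trans (ler_normB _ _)) // -mulrA mulr_natl mulr2n.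
by apply: lerD; apply: HC.
Qed.

Lemma sum_state_pairing_bound r j : (j <= r)%N -> exists C, forall tau N,
  `|\sum_(n < N) (state_pairing tau (n + r) (n + r + j) -
                  state_pairing tau (n + r) (n + r - j))|
    <= C * h tau ^+ 2.
Proof.
move=> jr.
have /choice[C HC] i := sum_field_pairing_bound i (r - i).
exists (2^-1 * \sum_(i < j) (C i + C i.+1)) => tau N.
have h0 : 0 < h tau by case/andP: (h01 tau).
under eq_bigr do rewrite state_pairing_central ?(leq_trans jr) ?leq_addl //.
rewrite -mulr_sumr normrM exchange_big /= gtr0_norm ?divr_gt0 //.
have -> : forall c : R, 2^-1 * c * h tau ^+ 2 = h tau / 2 * (c * h tau).
  by move=> c; ring.
apply: ler_wpM2l; first by rewrite ltW // divr_gt0.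
rewrite mulr_suml (le_trans (ler_norm_sum _ _ _)) //; apply: ler_sum => i _.
have part k : (k <= j)%N ->
    `|\sum_(n < N) (field_pairing tau (n + r) (n + r + k) -
        field_pairing tau (n + r - k) (n + r))| <= C k * h tau.
  move=> kj; have kr : (k <= r)%N by rewrite (leq_trans kj).
  have := HC k tau N; congr (`|_| <= _); apply: eq_bigr => n _.
  have -> : (n + (r - k) + k = n + r)%N by rewrite -addnA subnK.
  by have -> : (n + (r - k) = n + r - k)%N by rewrite addnBA.
rewrite big_split /= mulrDl (le_trans (ler_normD _ _)) // lerD ?part //.
exact: ltnW.
Qed.

(** One step is the chain rule for the forward difference, exact on affine
    polynomials: its main part is h/2 times the pairing of consecutive values of
    the field, again O(h). *)
Lemma energy_local_error a : exists C, forall tau n,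
  `|H tau (n + a)%N - H tau n| <= C * h tau ^+ 2.
Proof.
have [C1 HC1] := energy_rule (isT : 0 < 2)%N (isT : 0 <= 1)%N
  (@forward_difference_rule R).
have [C2 HC2] := field_pairing_bound 1.
have one tau n : `|H tau n.+1 - H tau n| <= (C1 + 2^-1 * C2) * h tau ^+ 2.
  have := HC1 tau n; rewrite /= addn0 addn1.
  rewrite (_ : \sum_i _ = state_pairing tau n n.+1 - state_pairing tau n n);
    last first.
    by rewrite -sumrB; apply: eq_bigr => i _; ring.
  rewrite state_pairing_step => E.
  rewrite -[X in `|X|](subrK
    (h tau / 2 * (field_pairing tau n n + field_pairing tau n n.+1))).
  rewrite (le_trans (ler_normD _ _)) // mulrDl lerD //.
  have -> : field_pairing tau n n = 0.
    by apply: big1 => i _; ring.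
  have h0 : 0 < h tau by case/andP: (h01 tau).
  rewrite add0r normrM gtr0_norm ?divr_gt0 //.
  have -> : 2^-1 * C2 * h tau ^+ 2 = h tau / 2 * (C2 * h tau) by ring.
  apply: ler_wpM2l; first by rewrite ltW ?divr_gt0.
  by have := HC2 tau n; rewrite addn1.
elim: a => [|a [C HC]].
  by exists 0 => tau n; rewrite addn0 subrr normr0 mul0r.
exists (C1 + 2^-1 * C2 + C) => tau n; rewrite addnS.
rewrite -(subrKA (H tau (n + a)%N)) (le_trans (ler_normD _ _)) //.
by rewrite mulrDl lerD.
Qed.

(** [lamH] is the central formula applied to the energy and [D] its symplectic
    main part; both have sums over [n < N] that reduce to boundary terms. *)
Lemma energy_long_time r : (0 < r)%N -> exists C, forall tau N,
  `|H tau N - H tau 0%N| <= C * (h tau ^+ 2 + N%:R * h tau ^+ r.*2.+1).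
Proof.
move=> r0; have [beta Hb] := exists_central_weights R r.
have rule := central_difference_rule r0 Hb.
have rr : (r <= r.*2)%N by rewrite -addnn leq_addr.
have [C1 HC1] := energy_rule (ltn0Sn _) rr rule.
have /choice[C2 HC2] : forall j : 'I_r, exists C, forall tau N,
    `|\sum_(n < N) (state_pairing tau (n + r) (n + r + j.+1) -
       state_pairing tau (n + r) (n + r - j.+1))| <= C * h tau ^+ 2.
  by move=> j; apply: sum_state_pairing_bound.
have /choice[C3 HC3] a := energy_local_error a.
pose S := \sum_(j < r) `|beta j| * (`|C2 j| +
   \sum_(k < j.+1.*2) 2 * `|C3 (k + (r - j.+1))%N|).
have S0 : 0 <= S.
  by apply: sumr_ge0 => j _; rewrite mulr_ge0 // addr_ge0 // sumr_ge0.
exists (`|C1| + S) => tau N.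
have h0 : 0 < h tau by case/andP: (h01 tau).
have hX k : 0 <= h tau ^+ k by rewrite exprn_ge0 // ltW.
pose lamH n := central_difference beta r (fun l => H tau (n + l)%N).
pose D n := \sum_(j < r) beta j * (state_pairing tau (n + r) (n + r + j.+1) -
   state_pairing tau (n + r) (n + r - j.+1)).
have lamD n : `|lamH n - D n| <= `|C1| * h tau ^+ r.*2.+1.
  apply: le_trans (_ : C1 * h tau ^+ r.*2.+1 <= _); last first.
    by rewrite ler_wpM2r // ler_norm.
  have := HC1 tau n; congr (`|_ - _| <= _).
  have E i : true -> p tau (n + r)%N 0 i *
      central_difference beta r (fun l => momentum i tau (n + l)%N) -
      force i tau (n + r)%N *
      central_difference beta r (fun l => y tau (n + l)%N 0 i) =
      \sum_(j < r) beta j *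
        ((p tau (n + r)%N 0 i * momentum i tau (n + r + j.+1)%N -
          force i tau (n + r)%N * y tau (n + r + j.+1)%N 0 i) -
         (p tau (n + r)%N 0 i * momentum i tau (n + r - j.+1)%N -
          force i tau (n + r)%N * y tau (n + r - j.+1)%N 0 i)).
    move=> _; rewrite !mulr_sumr -sumrB; apply: eq_bigr => j _.
    by rewrite !addnA (addnBA n (ltn_ord j)); ring.
  rewrite (eq_bigr _ E) exchange_big /=; apply: eq_bigr => j _.
  by rewrite -mulr_sumr sumrB.
have sumD : `|\sum_(n < N) D n| <=
    (\sum_(j < r) `|beta j| * `|C2 j|) * h tau ^+ 2.
  rewrite exchange_big /= (le_trans (ler_norm_sum _ _ _)) // mulr_suml.
  apply: ler_sum => j _; rewrite -mulr_sumr normrM -mulrA ler_wpM2l //.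
  by rewrite (le_trans (HC2 j tau N)) // ler_wpM2r // ler_norm.
have sumlam : `|(H tau N - H tau 0%N) - \sum_(n < N) lamH n| <=
    (\sum_(j < r) `|beta j| *
      \sum_(k < j.+1.*2) 2 * `|C3 (k + (r - j.+1))%N|) * h tau ^+ 2.
  have -> : \sum_(n < N) lamH n = \sum_(j < r) beta j * \sum_(k < j.+1.*2)
      (H tau (N + k + (r - j.+1))%N - H tau (k + (r - j.+1))%N).
    rewrite exchange_big /=; apply: eq_bigr => j _.
    rewrite -mulr_sumr; congr (_ * _).
    rewrite -(sum_shift_sub (fun k => H tau (k + (r - j.+1))%N) j.+1.*2 N).
    apply: eq_bigr => n _; congr (H tau _ - _).
    by rewrite -addnn -!addnA subnKC // [(_ + r)%N]addnC.
  have -> : H tau N - H tau 0%N = \sum_(j < r) beta j * \sum_(k < j.+1.*2)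
      (H tau N - H tau 0%N).
    (* Exactness on the identity: the weights times the distances of their
       nodes add up to 1. *)
    rewrite -[LHS]mul1r -[1](Hb 0%N r0) mulr_sumr mulr_suml.
    apply: eq_bigr => j _; rewrite sumr_const card_ord expr1.
    by rewrite -(mulr_natr (_ - _)) -mul2n natrM; ring.
  rewrite -sumrB (le_trans (ler_norm_sum _ _ _)) // mulr_suml.
  apply: ler_sum => j _; rewrite -mulrBr normrM -mulrA ler_wpM2l // -sumrB.
  rewrite (le_trans (ler_norm_sum _ _ _)) // mulr_suml; apply: ler_sum => k _.
  rewrite -addnA; set a := (k + (r - j.+1))%N.
  rewrite (_ : _ - _ = (H tau a - H tau 0%N) - (H tau (N + a)%N - H tau N));
    last by ring.
  have Ha n : `|H tau (n + a)%N - H tau n| <= `|C3 a| * h tau ^+ 2.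
    by rewrite (le_trans (HC3 a tau n)) // ler_wpM2r // ler_norm.
  rewrite (le_trans (ler_normB _ _)) // -mulrA mulr_natl mulr2n lerD //.
  exact: (Ha 0%N).
have sumE : `|\sum_(n < N) (lamH n - D n)| <= N%:R * (`|C1| * h tau ^+ r.*2.+1).
  rewrite (le_trans (ler_norm_sum _ _ _)) //.
  apply: le_trans (_ : \sum_(n < N) `|C1| * h tau ^+ r.*2.+1 <= _).
    by apply: ler_sum => n _.
  by rewrite sumr_const card_ord mulr_natl.
have -> : H tau N - H tau 0%N = (H tau N - H tau 0%N - \sum_(n < N) lamH n) +
    (\sum_(n < N) (lamH n - D n) + \sum_(n < N) D n).
  by rewrite sumrB; ring.
have SE : S = \sum_(j < r) `|beta j| * `|C2 j| + \sum_(j < r) `|beta j| *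
      \sum_(k < j.+1.*2) 2 * `|C3 (k + (r - j.+1))%N|.
  by rewrite -big_split; apply: eq_bigr => j _; rewrite mulrDr.
rewrite (le_trans (ler_normD _ _)) //.
apply: le_trans (lerD sumlam (le_trans (ler_normD _ _) (lerD sumE sumD))) _.
rewrite -subr_ge0.
rewrite [X in 0 <= X](_ : _ =
  `|C1| * h tau ^+ 2 + S * (N%:R * h tau ^+ r.*2.+1)).
  by rewrite addr_ge0 // mulr_ge0 // mulr_ge0.
by rewrite SE; ring.
Qed.

End TrapezoidalRule.

(** * The two-step method as a trapezoidal rule *)

Lemma trJ_mulZ (R : realType) (A : 'rV[R]_3 -> 'rV[R]_3) a (y w : 'rV[R]_3) :
  trJ_mul A y (a *: w) = a *: trJ_mul A y w.
Proof. by rewrite /trJ_mul scalemxAl. Qed.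

Section TwoStepMethod.
Variables (R : realType) (A F : 'rV[R]_3 -> 'rV[R]_3) (U : 'rV[R]_3 -> R^o).
Hypotheses (sA : smooth A) (hF : forall y, F y = - grad U y).
Variables (h : R) (x v : nat -> 'rV[R]_3).
Hypotheses (h0 : 0 < h) (xv : TSM2 A F h x v).

Lemma TSM2_increment n : x n.+1 - x n = h *: midpoint v n.
Proof.
have [_ vE] := xv; rewrite /midpoint vE.
apply/rowP => i; rewrite !mxE; field; exact: lt0r_neq0.
Qed.

Lemma TSM2_position_step n i :
  midpoint x n.+1 0 i - midpoint x n 0 i =
  h * (2^-1 * (midpoint v n 0 i + midpoint v n.+1 0 i)).
Proof.
rewrite mulrCA mulrDr.
have E m : h * midpoint v m 0 i = x m.+1 0 i - x m 0 i.
  have := congr1 (fun w : 'rV[R]_3 => w 0 i) (TSM2_increment m).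
  by rewrite !mxE => ->.
by rewrite !E !mxE; ring.
Qed.

Let q i n : R := midpoint v n 0 i + A (midpoint x n) 0 i.
Let G i n : R :=
  \sum_j midpoint v n 0 j * partial i (fun z => A z 0 j : R^o) (midpoint x n)
  - partial i U (midpoint x n).

(** The recursion divided by h, with the increments of [A] moved to the left. *)
Lemma TSM2_momentum_step n i :
  q i n.+1 - q i n = h * (2^-1 * (G i n + G i n.+1)).
Proof.
have GE m : G i m =
    trJ_mul A (midpoint x m) (midpoint v m) 0 i + F (midpoint x m) 0 i.
  by rewrite /G trJ_mulE // hF !mxE.
have hN0 : h != 0 by exact: lt0r_neq0.
have [rec _] := xv; have := rec n.
have -> : x n.+2 - 2 *: x n.+1 + x n = h *: (midpoint v n.+1 - midpoint v n).
  rewrite scalerBr -!TSM2_increment; apply/rowP => j; rewrite !mxE; ring.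
rewrite !TSM2_increment (trJ_mulZ A h _ (midpoint v n)).
rewrite (trJ_mulZ A h _ (midpoint v n.+1)).
rewrite !GE /q.
move: (midpoint v _) (midpoint v _) (A _) (A _) (F _) (F _)
  (trJ_mul A _ _) (trJ_mul A _ _) => v0 v1 A0 A1 F0 F1 t0 t1.
move=> /(congr1 (fun w : 'rV[R]_3 => w 0 i)); rewrite !mxE => E.
apply: (mulfI hN0); apply: subr0_eq.
by move/eqP: E; rewrite -subr_eq0 => /eqP <-; field.
Qed.

End TwoStepMethod.

Lemma norm_midpoint_coord (R : realType) (z : nat -> 'rV[R]_3) (M : R) n i :
  (forall m, `|z m| <= M) -> `|midpoint z n 0 i| <= M.
Proof.
move=> zM; rewrite !mxE normrM gtr0_norm ?invr_gt0 // mulrC ler_pdivrMr //.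
rewrite (le_trans (ler_normD _ _)) // mulr_natr mulr2n.
by apply: lerD; apply: le_trans (coord_le_norm _ _) _.
Qed.

Theorem theorem3p5 (R : realType)
    (A B F : 'rV[R]_3 -> 'rV[R]_3) (U : 'rV[R]_3 -> R^o)
    (hA : smooth A) (hU : smooth U)
    (hB : forall y, B y = curl A y) (hF : forall y, F y = - grad U y)
    (M : R) (K : set ('rV[R]_3 * 'rV[R]_3)) (hK : compact K)
    (N : nat) (hN : (2 <= N)%N) :
  exists C : R, forall (h : R) (x v : nat -> 'rV[R]_3),
    0 < h ->
    TSM2 A F h x v ->
    enorm (x 0%N) <= M -> enorm (v 0%N) <= M ->
    (forall n : nat, K (x n, v n)) ->
    forall n : nat, n%:R * h <= h ^- N ->
      `| energy U (midpoint x n) (midpoint v n)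
         - energy U (midpoint x 0%N) (midpoint v 0%N) |
        <= C * h ^+ 2.
Proof.
(* All step sizes up to 1 and all trajectories in K form a single family, so
   that the constants are common to them. *)
pose T := {c : R * (nat -> 'rV[R]_3) * (nat -> 'rV[R]_3) |
  [/\ 0 < c.1.1 <= 1, TSM2 A F c.1.1 c.1.2 c.2 & forall n, K (c.1.2 n, c.2 n)]}.
pose h (c : T) := (sval c).1.1.
pose y (c : T) := midpoint (sval c).1.2.
pose p (c : T) := midpoint (sval c).2.
have h01 c : 0 < h c <= 1 by have [] := svalP c.
have [D KD] : exists D : R, forall a b, K (a, b) -> `|a| <= D /\ `|b| <= D.
  have [D [_ HD]] := compact_bounded hK; exists (D + 1) => a b Kab.
  have DD : D < D + 1 by rewrite ltrDl.
  by have := HD _ DD (a, b) Kab; rewrite /= prod_normE /= ge_max => /andP[].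
have yD i : exists C, forall c n, `|y c n 0 i| <= C.
  exists D => c n; apply: norm_midpoint_coord => m.
  by have [_ _ /(_ m)/KD[]] := svalP c.
have pD i : exists C, forall c n, `|p c n 0 i| <= C.
  exists D => c n; apply: norm_midpoint_coord => m.
  by have [_ _ /(_ m)/KD[]] := svalP c.
have ystep i c n : y c n.+1 0 i - y c n 0 i =
    h c * (2^-1 * (p c n 0 i + p c n.+1 0 i)).
  by have [/andP[h0 _] tsm _] := svalP c; exact: (TSM2_position_step h0 tsm).
have qstep i c n : momentum A y p i c n.+1 - momentum A y p i c n =
    h c * (2^-1 * (force A U y p i c n + force A U y p i c n.+1)).
  have [/andP[h0 _] tsm _] := svalP c.
  exact: (TSM2_momentum_step hA hF h0 tsm).
have N0 : (0 < N)%N by exact: leq_trans hN.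
have [C HC] := energy_long_time hA hU h01 ystep qstep yD pD N0.
exists (2 * `|C|) => h' x v h'0 tsm _ _ xvK [|n] hn.
  by rewrite subrr normr0 mulr_ge0 ?sqr_ge0 //; exact: mulr_ge0.
have h'1 : h' <= 1.
  rewrite leNgt; apply/negP => h1.
  have : 1 < h' ^- N.
    apply: lt_le_trans hn; apply: lt_le_trans h1 _.
    by rewrite ler_peMl ?ler1n // ltW.
  by rewrite ltNge invf_le1 ?exprn_gt0 // exprn_ege1 // ltW.
pose c := (h', x, v).
have adm : [/\ 0 < c.1.1 <= 1, TSM2 A F c.1.1 c.1.2 c.2 &
    forall n, K (c.1.2 n, c.2 n)] by split=> //=; rewrite h'0.
have := HC (exist _ c adm) n.+1; rewrite /h /y /p /=.
move=> /le_trans; apply.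
have hX k : 0 <= h' ^+ k by rewrite exprn_ge0 // ltW.
have key : n.+1%:R * h' ^+ N.*2.+1 <= h' ^+ 2.
  apply: le_trans (_ : h' ^+ N <= _); last first.
    by rewrite -(subnK hN) exprD ler_piMl // exprn_ile1 // ltW.
  rewrite exprS mulrA (le_trans (ler_wpM2r (hX _) hn)) //.
  by rewrite -addnn exprD mulrA mulVf ?mul1r // gt_eqF // exprn_gt0.
have -> : 2 * `|C| * h' ^+ 2 = `|C| * (h' ^+ 2 + h' ^+ 2) by ring.
apply: le_trans (_ : `|C| * (h' ^+ 2 + n.+1%:R * h' ^+ N.*2.+1) <= _).
  by rewrite ler_wpM2r ?ler_norm // addr_ge0 // mulr_ge0.
by rewrite ler_wpM2l // lerD2l.
Qed.
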